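(* Let $\mathcal M$ be an MR-algebra and $J$ a g-cover of $\mathcal M$. Then $J$ is a filter: $J$ is upwards closed, and for all $x,y\in J$ the meet $x\wedge y$ exists in $\mathcal M$ and belongs to $J$.
   Context: A cubic algebra is a join-semilattice $\mathcal L$ with top $\mathbf 1$ and a binary operation $\Delta$ such that: if $x\le y$ then $\Delta(y,x)\vee x=y$; if $x\le y\le z$ then $\Delta(z,\Delta(y,x))=\Delta(\Delta(z,y),\Delta(z,x))$; if $x\le y$ then $\Delta(y,\Delta(y,x))=x$; if $x\le y\le z$ then $\Delta(z,x)\le\Delta(z,y)$; and with $xy:=\Delta(\mathbf 1,\Delta(x\vee y,y))\vee y$ one has $(xy)y=x\vee y$ and $x(yz)=y(xz)$. An MR-algebra is a cubic algebra such that whenever $a,b<x$: $\Delta(x,a)\vee b<x$ iff $a\wedge b$ does not exist. With the operation $xy$, a cubic algebra is an implication algebra; an implication subalgebra is a subset closed under it. In a cubic algebra, $a\sim b$ iff $\Delta(a\vee b,a)=b$; $\sim$ is an equivalence relation and $\mathcal L/\!\sim$ is an implication algebra with order $[a]\le[b]$ iff $\Delta(a\vee b,a)\le b$, join $[a]\vee[b]=[a\vee\Delta(a\vee b,b)]$, implication $[a]\to[b]=[\Delta(a\vee b,a)\,b]$. With $\eta\colon\mathcal L\to\mathcal L/\!\sim$ the quotient map, a g-cover of $\mathcal L$ is an upwards-closed implication subalgebra $J$ such that $\eta|_J\colon J\to\mathcal L/\!\sim$ is an isomorphism of implication algebras. *)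

(* Defs.v *)
From HB Require Import structures.
From mathcomp Require Import all_boot all_order.
From mathcomp Require Import classical_sets functions.

Set Implicit Arguments.
Unset Strict Implicit.
Unset Printing Implicit Defensive.

Import Order.Theory.
Local Open Scope order_scope.

(* The implication [xy := Delta(1, Delta(x \/ y, y)) \/ y], for an arbitrary
   binary operation [D], so that it can be used in the axioms below. *)
Definition cubic_imp_of d (L : tJoinSemilatticeType d) (D : L -> L -> L)
    (x y : L) : L :=
  D \top (D (x `|` y) y) `|` y.

HB.mixin Record JoinSemilattice_isCubic d L of Order.TJoinSemilattice d L := {
  Delta : L -> L -> L;
  Delta_joinK : forall x y : L, x <= y -> Delta y x `|` x = y;
  Delta_Delta : forall x y z : L, x <= y -> y <= z ->
    Delta z (Delta y x) = Delta (Delta z y) (Delta z x);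
  DeltaK : forall x y : L, x <= y -> Delta y (Delta y x) = x;
  Delta_le : forall x y z : L, x <= y -> y <= z -> Delta z x <= Delta z y;
  cubic_impK : forall x y : L,
    cubic_imp_of Delta (cubic_imp_of Delta x y) y = x `|` y;
  cubic_impCA : forall x y z : L,
    cubic_imp_of Delta x (cubic_imp_of Delta y z)
      = cubic_imp_of Delta y (cubic_imp_of Delta x z)
}.

#[short(type="cubicAlgType")]
HB.structure Definition CubicAlgebra d :=
  { L of Order.TJoinSemilattice d L & JoinSemilattice_isCubic d L }.

(* [c] is the meet of [a] and [b]; in a join-semilattice it need not exist. *)
Definition is_meet d (L : porderType d) (a b c : L) : Prop :=
  [/\ c <= a, c <= b & forall e : L, e <= a -> e <= b -> e <= c].

Definition has_meet d (L : porderType d) (a b : L) : Prop :=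
  exists c : L, is_meet a b c.

HB.mixin Record Cubic_isMR d L of CubicAlgebra d L := {
  MR_axiom : forall x a b : L, a < x -> b < x ->
    (Delta x a `|` b < x) <-> ~ has_meet a b
}.

#[short(type="mrAlgType")]
HB.structure Definition MRAlgebra d :=
  { L of CubicAlgebra d L & Cubic_isMR d L }.

Section CubicQuotient.
Variables (d : Order.disp_t) (L : cubicAlgType d).
Implicit Types (a b x y : L) (A B J : set L).

Definition cubic_imp : L -> L -> L := cubic_imp_of (@Delta d L).

Definition cubic_sim a b : Prop := Delta (a `|` b) a = b.

(* The elements of L/~ are the equivalence classes, as subsets of L. *)
Definition eta a : set L := [set b | cubic_sim a b]%classic.

Definition cubic_quot : set (set L) := range eta.

(* [a] -> [b] = [Delta(a \/ b, a) b], where a and b range over all the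
   representatives of the two classes. The class on the right does not depend
   on the representatives, so the union below is that class. *)
Definition quot_imp A B : set L :=
  (\bigcup_(a in A) \bigcup_(b in B) 
    eta (cubic_imp (Delta (a `|` b)%O a) b))%classic.

Definition up_closed J : Prop := forall x y, J x -> x <= y -> J y.

Definition imp_subalgebra J : Prop :=
  forall x y, J x -> J y -> J (cubic_imp x y).

Definition is_g_cover J : Prop :=
  [/\ up_closed J, imp_subalgebra J, set_bij J cubic_quot eta &
      forall x y, J x -> J y -> eta (cubic_imp x y) = quot_imp (eta x) (eta y)].

Definition is_filter J : Prop :=
  up_closed J /\
  forall x y, J x -> J y -> exists2 m : L, is_meet x y m & J m.

End CubicQuotient.

(* Main.v *)
Require Import Defs.
From mathcomp Require Import all_boot all_order classical_sets.
From mathcomp Require Import boolp.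

(** A g-cover [J] reflects the order of the quotient: if [j, k] are in [J] and
    [a <= b] for some [a ~ j] and [b ~ k], then [j <= k]. If
    [x, y] in [J] had no meet, then the MR axiom would give
    [w := Delta(x \/ y, x) \/ y < x \/ y]; the representative of [w] in [J] is
    an upper bound of [x] and [y], hence equal to [x \/ y], so that
    [w ~ x \/ y] with [w < x \/ y], which is impossible. Finally, the
    representative in [J] of the meet [m] of [x] and [y] lies below [x] and
    [y], hence below [m], and [J] is upwards closed. *)

Import Order.Theory.
Local Open Scope order_scope.

Section CubicTheory.
Context {d : Order.disp_t} {L : cubicAlgType d}.
Implicit Types (a b x y : L) (J : set L).

Lemma Delta_leq x y : x <= y -> Delta y x <= y.
Proof. by move=> /Delta_joinK {2}<-; exact: leUl. Qed.

Lemma Delta_refl x : Delta x x = x.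
Proof.
(* For the other inequality, [x = Delta x (Delta x x) <= Delta x x] by monotonicity. *)
apply/le_anti; rewrite Delta_leq //=.
by rewrite -{1}(DeltaK _ _ (lexx x)) Delta_le ?Delta_leq.
Qed.

Lemma cubic_sim_refl x : cubic_sim x x.
Proof. by rewrite /cubic_sim joinxx Delta_refl. Qed.

Lemma cubic_sim_Delta x y : x <= y -> cubic_sim x (Delta y x).
Proof. by move=> xy; rewrite /cubic_sim joinC Delta_joinK. Qed.

Lemma cubic_sim_ge x y : y <= x -> cubic_sim x y -> x = y.
Proof. by move=> yx; rewrite /cubic_sim (join_l yx) Delta_refl. Qed.

Lemma cubic_sim_top x : cubic_sim x \top -> x = \top.
Proof.
rewrite /cubic_sim joinx1 => xT.
by rewrite -(DeltaK x \top (lex1 x)) xT Delta_refl.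
Qed.

Lemma cubic_imp_eq1 x y : x <= y -> cubic_imp x y = \top.
Proof.
move=> xy; rewrite /cubic_imp /cubic_imp_of (join_r xy) Delta_refl.
by rewrite Delta_joinK ?lex1.
Qed.

Lemma cubic_imp1x x : cubic_imp \top x = x.
Proof. by rewrite /cubic_imp /cubic_imp_of join1x DeltaK ?lex1 ?joinxx. Qed.

(** The axiom [(xy)y = x \/ y] collapses to [1y = y]. *)
Lemma le_cubic_imp x y : cubic_imp x y = \top -> x <= y.
Proof.
move=> xyT; apply/join_idPl.
by rewrite joinC -cubic_impK -!/(cubic_imp _ _) xyT cubic_imp1x.
Qed.

Lemma g_cover_repr J : is_g_cover J -> forall a, exists2 j, J j & eta j = eta a.
Proof.
by move=> [_ _ [_ _ eta_surj] _] a; have [|j Jj <-] := eta_surj (eta a);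
  [exists a | exists j].
Qed.

(** Computed with the representatives [a <= b], the implication of the two classes contains [\top],
    which is equivalent only to itself; hence [jk = \top]. *)
Lemma g_cover_le J j k a b : is_g_cover J -> J j -> J k ->
  eta j a -> eta k b -> a <= b -> j <= k.
Proof.
move=> [_ _ _ etaM] Jj Jk ja kb ab; apply/le_cubic_imp/cubic_sim_top.
suff: eta (cubic_imp j k) \top by [].
rewrite etaM //; exists a => //; exists b => //.
rewrite (join_r ab) cubic_imp_eq1 ?Delta_leq //; exact: cubic_sim_refl.
Qed.

End CubicTheory.

Lemma g_cover_has_meet (d : Order.disp_t) (M : mrAlgType d) (J : set M) (x y : M) :
  is_g_cover J -> J x -> J y -> has_meet x y.
Proof.
move=> hJ Jx Jy; set z := x `|` y.
(* Once comparable pairs are settled, [x] and [y] lie strictly below [z], as [MR_axiom] requires. *)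
have [xy|nxy] := boolP (x <= y); first by exists x; split.
have [yx|nyx] := boolP (y <= x); first by exists y; split.
have ltxz : x < z by rewrite lt_def leUl andbT eq_joinl.
have ltyz : y < z by rewrite lt_def leUr andbT /z eq_joinr.
apply: contrapT => /(MR_axiom _ _ _ ltxz ltyz).
set w := (_ `|` y) => ltwz.
have [upJ _ _ _] := hJ; have Jz : J z by apply: upJ Jx (leUl _ _).
have [j Jj jw] := g_cover_repr J hJ w.
have ejw : eta j w by rewrite jw; exact: cubic_sim_refl.
have xj : x <= j.
  (* The representative of the class of [x] lying below [w] is [Delta z x]. *)
  apply: (g_cover_le _ _ _ _ _ hJ Jx Jj _ ejw (leUl _ _)).
  exact: cubic_sim_Delta (ltW ltxz).
have yj : y <= j.
  by apply: (g_cover_le _ _ _ _ _ hJ Jy Jj _ ejw (leUr _ _)); exact: cubic_sim_refl.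
have jz : j <= z.
  by apply: (g_cover_le _ _ _ _ _ hJ Jj Jz ejw _ (ltW ltwz)); exact: cubic_sim_refl.
have ejz : j = z by apply/le_anti; rewrite jz leUx xj yj.
rewrite ejz in ejw; have zw := cubic_sim_ge _ _ (ltW ltwz) ejw.
by rewrite -zw ltxx in ltwz.
Qed.

Theorem theorem5p4 (d : Order.disp_t) (M : mrAlgType d) (J : set M)
  (hJ : is_g_cover J) : is_filter J.
Proof.
have [upJ _ _ _] := hJ; split=> // x y Jx Jy.
have [m [mx my m_max]] := g_cover_has_meet _ _ _ _ _ hJ Jx Jy.
exists m => //.
have [j Jj jm] := g_cover_repr J hJ m.
have ejm : eta j m by rewrite jm; exact: cubic_sim_refl.
apply: (upJ j) => //; apply: m_max.
- exact: (g_cover_le _ _ _ _ _ hJ Jj Jx ejm (cubic_sim_refl _) mx).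
- exact: (g_cover_le _ _ _ _ _ hJ Jj Jy ejm (cubic_sim_refl _) my).
Qed.
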